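(* Let $X$ and $Y$ be sets and let $R\subseteq X\times Y$ be a relation. Let $E(R)$ be the rectangle complex of $R$ and $D(R)$ the Dowker complex of $R$. Then the simplicial map $\pi_R:E(R)\to D(R)$ given on vertices by $\pi_R(x,y)=x$ induces a homotopy equivalence $|\pi_R|:|E(R)|\to|D(R)|$ on geometric realizations.
   Context: A relation is a triple of sets $(R,X,Y)$ with $R\subseteq X\times Y$; no finiteness is assumed on $X$, $Y$ or $R$. A simplicial complex is a pair $(K,V)$ consisting of a vertex set $V$ and a set $K$ of non-empty finite subsets of $V$ (the simplices) such that every non-empty subset of an element of $K$ is in $K$. It is not required that $\{v\}\in K$ for every $v\in V$. A simplicial map $F:(K,V)\to(K',V')$ is a function $F:V\to V'$ such that $\sigma\in K$ implies $F(\sigma)=\{F(s)\mid s\in\sigma\}\in K'$. The geometric realization of $(K,V)$ is denoted $|K|$; it is the usual one, with the topology coherent with its closed simplices. A simplicial map $F$ induces a continuous map $|F|:|K|\to|K'|$. Elements $v\in V$ with $\{v\}\notin K$ contribute no points to $|K|$. The Dowker complex of $(R,X,Y)$ is the simplicial complex with vertex set $X$ and simplices $$D(R)=\{\sigma\subseteq X \text{ finite, non-empty}\mid \exists\, y\in Y \text{ with } \sigma\times\{y\}\subseteq R\}.$$ Let $\pi_R:R\to X$, $(x,y)\mapsto x$, and $\widehat{\pi}_R:R\to Y$, $(x,y)\mapsto y$, be the coordinate projections. The rectangle complex of $(R,X,Y)$ is the simplicial complex with vertex set $R$ and simplices $$E(R)=\{\tau\subseteq R\text{ finite, non-empty}\mid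 \pi_R(\tau)\times\widehat{\pi}_R(\tau)\subseteq R\},$$ that is, the finite non-empty subsets of $R$ contained in a finite subset of $R$ of the form $U\times V$ with $U\subseteq X$, $V\subseteq Y$. The function $\pi_R:R\to X$ defines a simplicial map $\pi_R:E(R)\to D(R)$. *)

(* Defs.v *)
From HB Require Import structures.
From mathcomp Require Import all_boot all_order all_algebra.
From mathcomp Require Import all_classical all_reals all_analysis.

Set Implicit Arguments.
Unset Strict Implicit.
Unset Printing Implicit Defensive.

Import Order.TTheory GRing.Theory Num.Theory.
Import numFieldNormedType.Exports.

Local Open Scope classical_set_scope.
Local Open Scope ring_scope.

(* The vertex set is the whole type V; singletons need not be simplices. *)
Record simplicial_complex (V : Type) := SimplicialComplex {
  simplices :> set V -> Prop;
  simplex_finite : forall s, simplices s -> finite_set s;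
  simplex_nonempty : forall s, simplices s -> s !=set0;
  simplex_face : forall s t,
    simplices s -> t !=set0 -> t `<=` s -> simplices t }.

Record simplicial_map (V W : Type)
    (K : simplicial_complex V) (L : simplicial_complex W) := SimplicialMap {
  vertex_map :> V -> W;
  simplicial_map_image : forall s, K s -> L (vertex_map @` s) }.

(* Points are given by barycentric coordinates. The type {classic V} is V
   with a classical choice structure, required by the finite sums. *)
Record realization (k : realType) (V : Type) (K : simplicial_complex V) :=
  Realization {
    bary : V -> k;
    bary_ge0 : forall v, 0 <= bary v;
    bary_support : K [set v | bary v != 0];
    bary_sum : \sum_(v \in [set: {classic V}]) bary v = 1 }.

Section realization_topology.
Context {k : realType} {V : Type} {K : simplicial_complex V}.

Definition closed_simplex (s : set V) : set (realization k K) :=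
  [set p | [set v | bary p v != 0] `<=` s].

(* Coherent topology: U is open iff its trace on each closed simplex is open
   there. As s is finite, pointwise convergence of barycentric coordinates is
   the Euclidean topology on closed_simplex s. *)
Definition coherent_open : set_system (realization k K) :=
  [set U | forall s, K s -> exists2 W : set {ptws V -> k}, open W &
    U `&` closed_simplex s = (@bary k V K @^-1` W) `&` closed_simplex s].

Lemma coherent_openT : coherent_open setT.
Proof. by move=> s _; exists setT; [exact: openT|rewrite preimage_setT]. Qed.

Lemma coherent_openI : setI_closed coherent_open.
Proof.
move=> A B oA oB s Ks; have [U oU AU] := oA s Ks; have [W oW BW] := oB s Ks.
exists (U `&` W); first exact: openI.
by rewrite preimage_setI [RHS]setIIl -AU -BW -setIIl.
Qed.

Lemma coherent_open_bigU (I : Type) (f : I -> set (realization k K)) :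
  (forall i, coherent_open (f i)) -> coherent_open (\bigcup_i f i).
Proof.
move=> fo s Ks.
pose P i W := @open {ptws V -> k} W /\
  f i `&` closed_simplex s = (@bary k V K @^-1` W) `&` closed_simplex s.
have [W WP] : {W : I -> set (V -> k) & forall i, P i (W i)}.
  by apply: (@choice _ _ P) => i; have [W oW e] := fo i s Ks; exists W.
exists (\bigcup_i W i); first by apply: bigcup_open => i _; case: (WP i).
rewrite preimage_bigcup !setI_bigcupl; apply: eq_bigcupr => i _.
by case: (WP i).
Qed.

HB.instance Definition _ := gen_eqMixin (realization k K).
HB.instance Definition _ := gen_choiceMixin (realization k K).
HB.instance Definition _ := isOpenTopological.Build (realization k K)
  coherent_openT coherent_openI coherent_open_bigU.

Lemma open_realizationE : @open (realization k K) = coherent_open.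
Proof. by []. Qed.

End realization_topology.

Section realization_map.
Context (k : realType) {V W : Type}.
Context {K : simplicial_complex V} {L : simplicial_complex W}.
Context (F : simplicial_map K L).

(* The affine extension of F: the vertex v is sent to F v. *)
Definition push_bary (p : realization k K) (w : W) : k :=
  \sum_(v \in [set v : {classic V} | F v = w]) bary p v.

Lemma push_bary_ge0 p w : 0 <= push_bary p w.
Proof. by apply: fsumr_ge0 => v _; exact: bary_ge0. Qed.

Let supp (p : realization k K) : set {classic V} := [set v | bary p v != 0].

Let supp_finite p : finite_set (supp p).
Proof. exact: simplex_finite (bary_support p). Qed.

Let push_baryE p w : push_bary p w =
  \sum_(v \in supp p) (if `[< F v = w >] then bary p v else 0).
Proof.
rewrite /push_bary fsbig_mkcond [RHS]fsbig_mkcond; apply: eq_fsbigr => v _.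
rewrite /patch.
have -> : (v \in [set u : {classic V} | F u = w]) = `[< F v = w >].
  by apply/idP/idP => [/set_mem/asboolT|/asboolP/mem_set].
case: (boolP (v \in supp p)) => // /negP vp; case: ifP => // _.
by apply: contrapT => /eqP pv; apply: vp; exact: mem_set.
Qed.

Lemma push_bary_support p :
  [set w | push_bary p w != 0] = F @` [set v | bary p v != 0].
Proof.
apply/seteqP; split=> [w /= pw|w [v /= pv Fvw]].
  apply: contrapT => nw; move/eqP: pw; apply; apply: fsbig1 => v /= Fvw.
  by apply: contrapT => /eqP pv; apply: nw; exists v.
apply/eqP; rewrite push_baryE => s0; move/eqP: pv; apply.
have g0 u : supp p u -> 0 <= if `[< F u = w >] then bary p u else 0.
  by move=> _; case: ifP => // _; exact: bary_ge0.
have [//|/eqP pv] := pselect (bary p v = 0).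
by have := pfsumr_eq0 (supp_finite p) g0 s0 pv; rewrite asboolT.
Qed.

Lemma push_bary_simplex p : L [set w | push_bary p w != 0].
Proof.
rewrite push_bary_support; apply: simplicial_map_image; exact: bary_support.
Qed.

Lemma push_bary_sum p : \sum_(w \in [set: {classic W}]) push_bary p w = 1.
Proof.
pose I : set {classic W} := F @` supp p.
have finI : finite_set I by exact: finite_image.
rewrite -(fsbig_widen I) //; last first.
  move=> w [_ nIw] /=; apply: contrapT => /eqP pw; apply: nIw.
  by rewrite /I /supp -push_bary_support.
under eq_fsbigr do rewrite push_baryE.
rewrite exchange_fsbig // -(bary_sum p).
rewrite -(fsbig_widen (supp p) setT) //; last first.
  by move=> v [_ /= /negP]; rewrite negbK => /eqP.
apply: eq_fsbigr => v /set_mem pv.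
rewrite -(fsbig_widen [set (F v : {classic W})]) //.
- by rewrite fsbig_set1 asboolT.
- by move=> _ ->; exists v.
- by move=> w [_ /= nw]; rewrite asboolF // => /esym.
Qed.

Definition realization_map (p : realization k K) : realization k L :=
  Realization (push_bary_ge0 p) (push_bary_simplex p) (push_bary_sum p).

End realization_map.

Arguments realization_map k {V W K L} F p.

Section homotopy.
Context (k : realType) {T U : topologicalType}.

Definition homotopic (f g : T -> U) : Prop :=
  exists H : T * k -> U,
    [/\ {within [set: T] `*` `[0, 1]%classic, continuous H},
        forall x, H (x, 0) = f x & forall x, H (x, 1) = g x].

End homotopy.

Definition homotopy_equivalence (k : realType) (T U : topologicalType)
    (f : T -> U) : Prop :=
  continuous f /\ exists g : U -> T,
    [/\ continuous g, homotopic k (g \o f) idfun & homotopic k (f \o g) idfun].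

Section dowker.
Context {X Y : Type} (R : set (X * Y)).

Definition dowker_simplices : set (set X) :=
  [set s | [/\ finite_set s, s !=set0 & exists y, s `*` [set y] `<=` R]].

Fact dowker_finite s : dowker_simplices s -> finite_set s.
Proof. by case. Qed.

Fact dowker_nonempty s : dowker_simplices s -> s !=set0.
Proof. by case. Qed.

Fact dowker_face s t : dowker_simplices s -> t !=set0 -> t `<=` s ->
  dowker_simplices t.
Proof.
move=> [fs _ [y sy]] t0 ts; split=> //; first exact: sub_finite_set fs.
by exists y => -[a b] [/= ta yb]; apply: sy; split=> //; exact: ts.
Qed.

Definition dowker_complex : simplicial_complex X :=
  SimplicialComplex dowker_finite dowker_nonempty dowker_face.

Definition rel_fst (r : R) : X := (val r).1.
Definition rel_snd (r : R) : Y := (val r).2.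

Definition rectangle_simplices : set (set R) :=
  [set t | [/\ finite_set t, t !=set0 &
               (rel_fst @` t) `*` (rel_snd @` t) `<=` R]].

Fact rectangle_finite s : rectangle_simplices s -> finite_set s.
Proof. by case. Qed.

Fact rectangle_nonempty s : rectangle_simplices s -> s !=set0.
Proof. by case. Qed.

Fact rectangle_face s t : rectangle_simplices s -> t !=set0 -> t `<=` s ->
  rectangle_simplices t.
Proof.
move=> [fs _ sR] t0 ts; split=> //; first exact: sub_finite_set fs.
by apply: subset_trans sR; apply: setSX; exact: image_subset.
Qed.

Definition rectangle_complex : simplicial_complex R :=
  SimplicialComplex rectangle_finite rectangle_nonempty rectangle_face.

Fact rel_fst_simplicial t : rectangle_complex t -> dowker_complex (rel_fst @` t).
Proof.
move=> [ft [r tr] tR]; split; [exact: finite_image|by exists (rel_fst r), r|].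
exists (rel_snd r); apply: subset_trans tR => -[a b] [/= ta ->].
by split=> //=; exists r.
Qed.

Definition rel_fst_map : simplicial_map rectangle_complex dowker_complex :=
  SimplicialMap rel_fst_simplicial.

End dowker.

(* Main.v *)
(* For a point p of |D(R)| let U be the set of vertices whose coordinate exceeds
   a threshold c(p) lying strictly between 0 and the largest coordinate, and
   choose a witness y_t for every simplex t of D(R). Each t with U <= t <= supp p
   has U x {y_t} <= R, so a product of a distribution on U and a distribution on
   the witnesses y_t is a point g(p) of |E(R)|, depending continuously on p. The
   support of pi(g(p)) lies in supp p, so pi g is homotopic to the identity by a
   straight line. For e in |E(R)| with p = pi(e), let h(e) be e with the vertices
   outside U x Y trimmed off: supp h(e) <= supp e, and supp h(e) and supp g(pi(e))
   span a common rectangle with first side U. Straight lines then join id to h and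
   h to g pi. *)
Require Import Defs.
From mathcomp Require Import all_boot all_order all_algebra.
From mathcomp Require Import all_classical all_reals all_analysis.

Set Implicit Arguments.
Unset Strict Implicit.
Unset Printing Implicit Defensive.

Import Order.TTheory GRing.Theory Num.Theory.
From mathcomp Require Import finmap lra.
Import numFieldNormedType.Exports.

Local Open Scope classical_set_scope.
Local Open Scope ring_scope.

(** * Finite power sets and pointwise convergence *)

Lemma finite_subsets (T : choiceType) (A : set T) :
  finite_set A -> finite_set [set B | B `<=` A].
Proof.
move=> fA.
apply: (@sub_finite_set _ _
  ((fun B : {fset T} => [set` B]) @` [set` fpowerset (fset_set A)])).
  move=> B /= BA; have fB := sub_finite_set BA fA.
  exists (fset_set B); last by rewrite fset_setK.
  by rewrite /= fpowersetE -fset_set_sub.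
by apply: finite_image; exact: finite_fset.
Qed.

Lemma ptws_eval_continuous (T : Type) (U : topologicalType) (t : T) :
  continuous (fun f : {ptws T -> U} => f t).
Proof.
move=> f A nA.
have /cvg_sup/(_ t) : (f : {ptws T -> U}) --> (f : {ptws T -> U}) by exact: cvg_id.
apply; exact: (@initial_continuous _ _ (fun g : T -> U => g t) f A nA).
Qed.

(** * The coherent topology, examined one closed simplex at a time *)

Section coherent_topology.
Context {k : realType} {V : Type} {K : simplicial_complex V}.
Implicit Types (p q : realization k K) (s : set V).

Lemma realization_ext p q : bary p =1 bary q -> p = q.
Proof.
move=> /funext; case: p => b p1 p2 p3; case: q => b' q1 q2 q3 /= e.
by subst b'; rewrite (Prop_irrelevance p1 q1) (Prop_irrelevance p2 q2)
  (Prop_irrelevance p3 q3).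
Qed.

Let bary_ptws (p : realization k K) : {ptws V -> k} := bary p.

(** For p in the closed simplex [s], this is its neighbourhood filter in the Euclidean topology of
    that simplex, kept as a filter on all of |K| to avoid a subspace type. *)
Definition simplex_nbhs s p : set_system (realization k K) :=
  within (closed_simplex s) (nbhs (p : initial_topology bary_ptws)).

#[global] Instance simplex_nbhs_filter s p : Filter (simplex_nbhs s p).
Proof. exact: within_filter. Qed.

Lemma simplex_nbhs_bary s p v :
  (fun q => bary q v) @ simplex_nbhs s p --> bary p v.
Proof.
apply: cvg_within_filter.
apply: (@continuous_comp (initial_topology bary_ptws) {ptws V -> k} k bary_ptws
  (fun f => f v)).
  exact: initial_continuous.
exact: ptws_eval_continuous.
Qed.

Lemma open_simplexwise (U : set (realization k K)) :
  (forall s p, K s -> closed_simplex s p -> U p -> simplex_nbhs s p U) ->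
  open U.
Proof.
move=> nU; rewrite open_realizationE => s Ks.
(* The interior of the largest set with trace [U]: all functions except the coordinates of points of
   the simplex outside [U]. *)
exists (interior [set f : {ptws V -> k} |
  forall q, bary q = f -> closed_simplex s q -> U q]).
  exact: open_interior.
apply/seteqP; split=> p [] Up sp; split=> //.
  have := nU _ _ Ks sp Up; rewrite /simplex_nbhs /within /=.
  rewrite nbhsE => -[_ [[/= W oW <-] Wp] WU].
  apply: (filterS _ (open_nbhs_nbhs (conj oW Wp))) => f Wf q qf sq.
  by apply: WU => //; rewrite /= /bary_ptws qf.
by have /= := interior_subset Up; apply.
Qed.

Lemma open_realization_trace (U : set (realization k K)) s : open U -> K s ->
  exists2 W : set {ptws V -> k}, open W &
    U `&` closed_simplex s = (@bary k V K @^-1` W) `&` closed_simplex s.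
Proof. by rewrite open_realizationE => oU /oU. Qed.

(** Continuity of the inclusion of a closed simplex into |K|, in filter form. *)
Lemma simplex_nbhs_sub s p : K s -> closed_simplex s p ->
  nbhs p `<=` simplex_nbhs s p.
Proof.
move=> Ks sp A; rewrite nbhsE => -[U [oU Up] UA].
have [W oW UW] := open_realization_trace oU Ks.
have : nbhs (p : initial_topology bary_ptws) (bary_ptws @^-1` W).
  apply: open_nbhs_nbhs; split; first by exists W.
  by have [] : (@bary k V K @^-1` W `&` closed_simplex s) p by rewrite -UW.
apply: filterS => q Wq sq; apply: UA.
by have [] : (U `&` closed_simplex s) q by rewrite UW.
Qed.

Lemma simplex_nbhs_self s p : simplex_nbhs s p (closed_simplex s).
Proof. exact: withinT. Qed.

Lemma simplex_nbhs_singleton s p (A : set (realization k K)) :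
  simplex_nbhs s p A -> closed_simplex s p -> A p.
Proof. by move=> /(@nbhs_singleton (initial_topology bary_ptws)). Qed.

Lemma bary_continuous v : continuous (fun p : realization k K => bary p v).
Proof.
apply/continuousP => A oA; apply: open_simplexwise => s p Ks sp Ap.
by apply: (@simplex_nbhs_bary s p v); exact: open_nbhs_nbhs.
Qed.

(** Asking for [h'] on all of |K| is harmless for the intended use: an infinite sum of coordinates
    agrees on a closed simplex with a finite sum. *)
Lemma continuous_simplexwise (T : topologicalType) (h : realization k K -> T) :
  (forall s, K s -> exists2 h', continuous h' & forall p, closed_simplex s p -> h p = h' p) ->
  continuous h.
Proof.
move=> hs; apply/continuousP => A oA; apply: open_simplexwise => s p Ks sp Ap.
have [h' ch' hh'] := hs _ Ks.
have : nbhs p (h' @^-1` A).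
  have hp : h p = h' p by exact: hh'.
  by apply: ch'; apply: open_nbhs_nbhs; split=> //; rewrite -hp.
move=> /(simplex_nbhs_sub Ks sp) H.
have := simplex_nbhs_self s p; apply: filterS2 H => q Aq sq.
by rewrite /= hh'.
Qed.

(* The coherent topology agrees with pointwise convergence on a finite
   subcomplex, because only finitely many simplices have to be examined. *)
Lemma nbhs_finite_subcomplex (T : Type) (G : set_system T) {FG : Filter G}
    (F : set {classic V}) (h : T -> realization k K) p (U : set (realization k K)) :
  finite_set F -> (\forall x \near G, closed_simplex F (h x)) ->
  (forall v, (fun x => bary (h x) v) @ G --> bary p v) ->
  open U -> U p -> \forall x \near G, U (h x).
Proof.
move=> finF hF hp oU Up.
have step s : K s ->
    \forall x \near G, closed_simplex s (h x) -> U (h x).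
  move=> Ks; have [sp|nsp] := pselect (closed_simplex s p).
    have [W oW UW] := open_realization_trace oU Ks.
    have Wp : W (bary p).
      by have [] : (@bary k V K @^-1` W `&` closed_simplex s) p by rewrite -UW.
    have : (fun x => bary (h x)) @ G --> (bary p : {ptws V -> k}).
      apply/cvg_sup => v A; rewrite nbhsE => -[_ [[B oB <-] Bp] BA].
      have := hp v B (open_nbhs_nbhs (conj oB Bp)).
      by rewrite /nbhs /=; apply: filterS => x; exact: BA.
    move=> cvh.
    have GW : G [set x | W (bary (h x))].
      exact: (cvh W (open_nbhs_nbhs (conj oW Wp))).
    apply: filterS GW => x Wx sx.
    by have [] : (U `&` closed_simplex s) (h x) by rewrite UW.
  (* Off the closed simplex [s], some vertex outside [s] has a nonzero coordinate at [p]; it stays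
     nonzero nearby, so [h x] avoids the simplex. *)
  have [v [pv nsv]] : exists v, bary p v != 0 /\ ~ s v.
    by apply: contrapT => nv; apply: nsp => v pv; apply: contrapT => sv;
      apply: nv; exists v.
  have nv : nbhs (bary p v) [set x | x != 0].
    by apply: open_nbhs_nbhs; split=> //; exact: open_neq.
  have Gv : G [set x | bary (h x) v != 0] := hp v _ nv.
  by apply: filterS Gv => x /= hv /(_ v hv).
have step' : G (\bigcap_(s in [set` fset_set [set s | s `<=` F]])
    [set x | K s -> closed_simplex s (h x) -> U (h x)]).
  apply: filter_bigI => s _; have [Ks|nKs] := pselect (K s).
    by apply: filterS (step _ Ks) => x + _.
  by apply: filterS filterT => x _ /nKs.
(* The support of [h x] is one of the finitely many subsets of [F]. *)
apply: filterS2 hF step' => x hx /(_ [set v | bary (h x) v != 0]).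
apply; [|exact: bary_support|by []].
by rewrite /= in_fset_set; [exact: mem_set|exact: finite_subsets].
Qed.
End coherent_topology.

(** * Continuity on the product of |K| with the line *)

Section product_continuity.
Context {k : realType} {V W : Type}.
Context {K : simplicial_complex V} {L : simplicial_complex W}.

(* The product topology on |K| x k is the coherent one because k is locally
   compact: for a compact interval J, the tube lemma on each closed simplex makes
   [set p | forall t in J, U (H (p, t))] open. *)
Lemma continuous_prod_realization (H : realization k K * k -> realization k L) :
  (forall s, K s -> exists2 F : set {classic W}, finite_set F &
    forall p t, closed_simplex s p -> closed_simplex F (H (p, t))) ->
  (forall w, continuous (fun z => bary (H z) w)) ->
  continuous H.
Proof.
move=> Hfin Hbary.
(* Time comes first in the product filter, as [compact_near_coveringP] requires. *)
have Hloc s p t U : K s -> closed_simplex s p -> open U -> U (H (p, t)) ->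
    \forall t' \near t & q \near simplex_nbhs s p, U (H (q, t')).
  move=> Ks sp oU UH; have [F finF HF] := Hfin _ Ks.
  apply: (@nbhs_finite_subcomplex _ _ _ _ (filter_prod (nbhs t) (simplex_nbhs s p))
    _ F (fun z => H (z.2, z.1)) (H (p, t)) U) => //.
    exists (setT, closed_simplex s).
      by split; [exact: filterT|exact: simplex_nbhs_self].
    by move=> [t' q] [_ /= sq]; exact: HF.
  move=> w A /(Hbary w (p, t)) [[B C] [/= nB nC] BCA].
  exists (C, B); first by split=> //=; exact: simplex_nbhs_sub.
  by move=> [t' q] [/= Ct' Bq]; exact: (BCA (q, t')).
move=> [p0 t0] A; rewrite nbhsE => -[U [oU Up0] UA].
apply: (filterS UA).
pose s0 : set V := [set v | bary p0 v != 0].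
have Ks0 : K s0 by exact: bary_support.
have sp0 : closed_simplex s0 p0 by [].
have /nbhs_closedballP[r rU] : nbhs t0 [set t | U (H (p0, t))].
  have [[B C] /= [nB nC] BC] := Hloc _ _ _ _ Ks0 sp0 oU Up0.
  apply: filterS nB => t Bt; apply: (BC (t, p0)); split=> //=.
  exact: simplex_nbhs_singleton nC sp0.
pose J : set k := closed_ball t0 r%:num.
pose N : set (realization k K) := [set p | forall t, J t -> U (H (p, t))].
have oN : open N.
  apply: open_simplexwise => s p Ks sp Np.
  have cJ : compact J by exact: closed_ballR_compact.
  move/compact_near_coveringP : cJ => /(_ _ (simplex_nbhs s p)
    (fun q t => U (H (q, t))) _); apply => t Jt.
  by apply: Hloc => //; exact: Np.
exists (N, J); last by move=> [p t] [/= Np Jt]; exact: Np.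
by split; [exact: open_nbhs_nbhs|apply/nbhs_closedballP; exists r].
Qed.

End product_continuity.

(** * Continuity of real-valued expressions *)

Section real_valued_continuity.
Context {k : realType} {T : topologicalType}.
Implicit Types f g : T -> k.

Lemma continuous_add f g :
  continuous f -> continuous g -> continuous (fun x => f x + g x).
Proof. by move=> cf cg x; apply: cvgD; [exact: cf|exact: cg]. Qed.

Lemma continuous_sub f g :
  continuous f -> continuous g -> continuous (fun x => f x - g x).
Proof. by move=> cf cg x; apply: cvgB; [exact: cf|exact: cg]. Qed.

Lemma continuous_const (c : k) : continuous (fun _ : T => c).
Proof. by move=> x; exact: cvg_cst. Qed.

Lemma continuous_mul f g :
  continuous f -> continuous g -> continuous (fun x => f x * g x).
Proof. by move=> cf cg x; apply: cvgM; [exact: cf|exact: cg]. Qed.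

Lemma continuous_maxr f g :
  continuous f -> continuous g -> continuous (fun x => Num.max (f x) (g x)).
Proof. by move=> cf cg x; apply: continuous_max; [exact: cf|exact: cg]. Qed.

Lemma continuous_minr f g :
  continuous f -> continuous g -> continuous (fun x => Num.min (f x) (g x)).
Proof. by move=> cf cg x; apply: continuous_min; [exact: cf|exact: cg]. Qed.

Lemma continuous_sum (I : Type) (f : I -> T -> k) (r : seq I) :
  (forall i, continuous (f i)) -> continuous (fun x => \sum_(i <- r) f i x).
Proof.
move=> cf; apply: continuous_big => [|i _]; [exact: add_continuous|exact: cf].
Qed.

Lemma continuous_prod (I : Type) (f : I -> T -> k) (r : seq I) :
  (forall i, continuous (f i)) -> continuous (fun x => \prod_(i <- r) f i x).
Proof.
move=> cf; apply: continuous_big => [|i _]; [exact: mul_continuous|exact: cf].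
Qed.

End real_valued_continuity.

Lemma continuous_pair_cst (T U : topologicalType) (u : U) :
  continuous (fun t : T => (t, u)).
Proof. by move=> t; apply: (cvg_pair cvg_id (cvg_cst _)). Qed.

(** * Locally finite families of weights *)

Section weight_families.
Context {k : realType} {V W : Type}.
Context {K : simplicial_complex V}.

(* Local finiteness over each closed simplex, with continuous coordinates; for a
   map between realizations this implies continuity (see tame_continuous), whereas
   continuity of the coordinates alone does not. *)
Definition tame (Phi : realization k K -> W -> k) : Prop :=
  (forall s, K s -> exists2 F : set {classic W}, finite_set F &
    forall p, closed_simplex s p -> [set w | Phi p w != 0] `<=` F) /\
  forall w, continuous (fun p => Phi p w).

Lemma tame_sum_continuous (Phi : realization k K -> W -> k) (P : set {classic W}) :
  tame Phi -> continuous (fun p => \sum_(w \in P) Phi p w).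
Proof.
move=> [fPhi cPhi]; apply: continuous_simplexwise => s /fPhi[F finF PhiF].
have finPF : finite_set (P `&` F) by exact: finite_setIr.
exists (fun p => \sum_(w <- fset_set (P `&` F)) Phi p w).
  by apply: continuous_sum => w; exact: cPhi.
move=> p sp; rewrite -fsbig_finite//; apply/esym/fsbig_widen => // w [Pw nPFw] /=.
by apply: contrapT => /eqP pw; apply: nPFw; split=> //; exact: PhiF sp _ pw.
Qed.

End weight_families.

(** The finite bound [F] matters: a sum with infinite support is 0 by convention. *)
Lemma fsum_neq0 (k : realType) (I : choiceType) (w : I -> k) (A F : set I) i :
  (forall j, 0 <= w j) -> finite_set F -> [set j | w j != 0] `<=` F ->
  A i -> w i != 0 -> \sum_(j \in A) w j != 0.
Proof.
move=> w0 finF wF Ai wi; have finAF : finite_set (A `&` F) by exact: finite_setIr.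
rewrite -(fsbig_widen (A `&` F)) //; last first.
  by move=> j [Aj nAFj] /=; apply: contrapT => /eqP wj; apply: nAFj; split=> //; exact: wF.
apply/eqP => sum0; move/eqP: (wi); apply.
exact: (pfsumr_eq0 finAF (fun j _ => w0 j) sum0 (conj Ai (wF _ wi))).
Qed.

(** * Points of a realization from weights *)

Section realizations_from_weights.
Context {k : realType} {W : Type} {L : simplicial_complex W}.

Lemma realization_of_weights (w : W -> k) (s : set W) :
  (forall v, 0 <= w v) -> L s -> [set v | w v != 0] `<=` s ->
  \sum_(v \in [set: {classic W}]) w v = 1 ->
  exists q : realization k L, bary q = w.
Proof.
move=> w0 Ls ws w1.
have wL : L [set v | w v != 0].
  apply: simplex_face Ls _ ws; apply/set0P/eqP => w_eq0.
  suff : (0 : k) = 1 by move/eqP; rewrite eq_sym oner_eq0.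
  rewrite -w1; apply/esym/fsbig1 => v _; apply: contrapT => /eqP wv.
  by have : [set v | w v != 0] v by []; rewrite w_eq0.
by exists (Realization w0 wL w1).
Qed.

Lemma weights_sum_gt0 (w : W -> k) :
  (forall v, 0 <= w v) -> L [set v | w v != 0] ->
  0 < \sum_(v \in [set: {classic W}]) w v.
Proof.
move=> w0 Lw; have [v wv] := simplex_nonempty Lw.
rewrite lt_neqAle fsumr_ge0// andbT eq_sym.
exact: (@fsum_neq0 _ {classic W} _ _ _ v w0 (simplex_finite Lw)).
Qed.

Lemma bary_sum_seq (p : realization k L) (F : set {classic W}) :
  finite_set F -> closed_simplex F p ->
  \sum_(v <- fset_set F) bary p v = 1.
Proof.
move=> finF pF; rewrite -fsbig_finite// -(bary_sum p); apply: fsbig_widen => //.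
by move=> v [_ nFv] /=; apply: contrapT => /eqP pv; apply: nFv; exact: pF.
Qed.

End realizations_from_weights.

(** * Tame maps, normalization and contiguity *)

Section tame_maps.
Context {k : realType} {V W : Type}.
Context {K : simplicial_complex V} {L : simplicial_complex W}.

(** Follows from [continuous_prod_realization] for the homotopy constant in time, restricted to time
    0. *)
Lemma tame_continuous (phi : realization k K -> realization k L) :
  tame (fun p => bary (phi p)) -> continuous phi.
Proof.
move=> [fphi cphi].
have cphi1 : continuous (fun z : realization k K * k => phi z.1).
  apply: continuous_prod_realization => [s /fphi[F finF phiF]|w [p t]].
    by exists F => // p t; exact: phiF.
  apply: (@continuous_comp _ _ _ fst (fun p => bary (phi p) w)); first exact: cvg_fst.
  exact: cphi.
move=> p; apply: (@continuous_comp _ _ _ (fun p => (p, 0 : k)) (fun z => phi z.1)).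
  exact: continuous_pair_cst.
exact: cphi1.
Qed.

(** Divide by the total weight: it is positive because a simplex is non-empty, and continuous by
    local finiteness. *)
Lemma tame_normalize (Phi : realization k K -> W -> k) :
  tame Phi -> (forall p w, 0 <= Phi p w) ->
  (forall p, L [set w | Phi p w != 0]) ->
  exists phi : realization k K -> realization k L,
    tame (fun p => bary (phi p)) /\
    forall p, [set w | bary (phi p) w != 0] = [set w | Phi p w != 0].
Proof.
move=> tPhi Phi0 PhiL.
pose S p := \sum_(w \in [set: {classic W}]) Phi p w.
have S0 p : 0 < S p by exact: weights_sum_gt0.
have supp p : [set w | Phi p w / S p != 0] = [set w | Phi p w != 0].
  by apply/seteqP; split=> w /=; rewrite mulf_eq0 invr_eq0 (gt_eqF (S0 p)) orbF.
have /choice[phi phiE] : forall p, exists q : realization k L,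
    bary q = fun w => Phi p w / S p.
  move=> p; apply: (realization_of_weights _ (PhiL p)).
  - by move=> w; rewrite divr_ge0// ltW.
  - by rewrite supp.
  - pose P : set {classic W} := [set w | Phi p w != 0].
    have finP : finite_set P by exact: simplex_finite (PhiL p).
    rewrite -(fsbig_widen P) //; last first.
      by move=> v [_ /= /negP]; rewrite negbK => /eqP ->; rewrite mul0r.
    rewrite fsbig_finite// -mulr_suml -fsbig_finite//.
    suff -> : \sum_(v \in P) Phi p v = S p by rewrite divff// gt_eqF.
    by apply: fsbig_widen => // v [_ /= /negP]; rewrite negbK => /eqP.
exists phi; split; last by move=> p; rewrite phiE supp.
split=> [s /(tPhi.1)[F finF PhiF]|w].
  by exists F => // p sp; rewrite phiE supp; exact: PhiF.
have -> : (fun p => bary (phi p) w) = (fun p => Phi p w * (S p)^-1).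
  by apply/funext => p; rewrite phiE.
move=> p; apply: (@continuousM _ _ (Phi^~ w) (fun p => (S p)^-1)).
  exact: tPhi.2.
by apply: continuousV; [rewrite gt_eqF|exact: tame_sum_continuous].
Qed.

(* The coefficients a, b, c of phi, chi and psi trace the broken line from phi
   through chi to psi; a and c are never both nonzero. *)
Lemma contiguous_homotopic (phi chi psi : realization k K -> realization k L) :
  tame (fun p => bary (phi p)) -> tame (fun p => bary (chi p)) ->
  tame (fun p => bary (psi p)) ->
  (forall p, L ([set w | bary (phi p) w != 0] `|` [set w | bary (chi p) w != 0])) ->
  (forall p, L ([set w | bary (chi p) w != 0] `|` [set w | bary (psi p) w != 0])) ->
  homotopic k phi psi.
Proof.
move=> tphi tchi tpsi L1 L2.
(* [a] falls from 1 to 0 on the first half of the unit interval and [c] rises from 0 to 1 on the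
   second; clamping keeps the coefficients valid for every real t. *)
pose a (t : k) : k := Num.min 1 (Num.max 0 (1 - 2 * t)).
pose c (t : k) : k := Num.min 1 (Num.max 0 (2 * t - 1)).
pose b t := 1 - a t - c t.
have a0 t : 0 <= a t by rewrite /a le_min ler01 le_max lexx.
have c0 t : 0 <= c t by rewrite /c le_min ler01 le_max lexx.
have a1 t : a t <= 1 by rewrite /a ge_min lexx.
have c1 t : c t <= 1 by rewrite /c ge_min lexx.
have ac t : a t = 0 \/ c t = 0.
  have [t2|t2] := leP (2 * t) 1.
    by right; rewrite /c (max_idPl _) ?subr_le0// (min_idPr _)// ler01.
  by left; rewrite /a (max_idPl _) ?subr_le0 ?ltW// (min_idPr _)// ler01.
have b0 t : 0 <= b t by rewrite /b; case: (ac t) => ->; rewrite subr0 subr_ge0.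
pose w (z : realization k K * k) v :=
  a z.2 * bary (phi z.1) v + b z.2 * bary (chi z.1) v + c z.2 * bary (psi z.1) v.
(* As [a] or [c] vanishes, only two consecutive maps contribute, and their supports span a simplex
   by hypothesis. *)
have suppw z : exists2 S, L S & [set v | w z v != 0] `<=` S.
  case: (ac z.2) => coef0; [eexists; first exact: (L2 z.1)|
                            eexists; first exact: (L1 z.1)].
  - move=> v /=; rewrite /w coef0 mul0r add0r; apply: contra_neqP.
    move=> /not_orP[/negP/negPn/eqP -> /negP/negPn/eqP ->].
    by rewrite !mulr0 addr0.
  - move=> v /=; rewrite /w coef0 mul0r addr0; apply: contra_neqP.
    move=> /not_orP[/negP/negPn/eqP -> /negP/negPn/eqP ->].
    by rewrite !mulr0 addr0.
have sumw z : \sum_(v \in [set: {classic W}]) w z v = 1.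
  pose S : set {classic W} := [set v | bary (phi z.1) v != 0] `|`
    [set v | bary (chi z.1) v != 0] `|` [set v | bary (psi z.1) v != 0].
  have finS : finite_set S.
    by rewrite !finite_setU; split; [split|]; exact: simplex_finite (bary_support _).
  rewrite -(fsbig_widen S) // => [|v [_ nSv] /=]; last first.
    move: nSv => /not_orP[/not_orP[]].
    move=> /negP/negPn/eqP p0 /negP/negPn/eqP q0 /negP/negPn/eqP r0.
    by rewrite /w p0 q0 r0 !mulr0 !addr0.
  rewrite fsbig_finite// !big_split/= -!mulr_sumr !bary_sum_seq//.
  - by rewrite !mulr1 /b -addrA subrK addrC subrK.
  - by move=> v; right.
  - by move=> v; left; right.
  - by move=> v; left; left.
have /choice[H HE] : forall z, exists q : realization k L, bary q = w z.
  move=> z; have [S LS wS] := suppw z.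
  apply: realization_of_weights LS wS (sumw z) => v.
  by rewrite !addr_ge0// mulr_ge0// bary_ge0.
have c2 : continuous (fun t : k => 2 * t).
  by apply: continuous_mul => [|t]; [exact: continuous_const|exact: cvg_id].
have ca : continuous a.
  apply: continuous_minr; first exact: continuous_const.
  apply: continuous_maxr; first exact: continuous_const.
  by apply: continuous_sub => //; exact: continuous_const.
have cc : continuous c.
  apply: continuous_minr; first exact: continuous_const.
  apply: continuous_maxr; first exact: continuous_const.
  by apply: continuous_sub => //; exact: continuous_const.
have cb : continuous b.
  apply: continuous_sub => //; apply: continuous_sub => //.
  exact: continuous_const.
have cfst (f : realization k K -> k) :
    continuous f -> continuous (fun z : realization k K * k => f z.1).
  by move=> cf z; apply: (@continuous_comp _ _ _ fst f); [exact: cvg_fst|exact: cf].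
have csnd (f : k -> k) :
    continuous f -> continuous (fun z : realization k K * k => f z.2).
  by move=> cf z; apply: (@continuous_comp _ _ _ snd f); [exact: cvg_snd|exact: cf].
have cH : continuous H.
  apply: continuous_prod_realization => [s Ks|v].
    have [F1 finF1 HF1] := tphi.1 s Ks; have [F2 finF2 HF2] := tchi.1 s Ks.
    have [F3 finF3 HF3] := tpsi.1 s Ks.
    exists (F1 `|` F2 `|` F3); first by rewrite !finite_setU.
    move=> p t sp v; rewrite HE /w /=; apply: contra_neqP.
    move=> /not_orP[/not_orP[nF1 nF2] nF3].
    have -> : bary (phi p) v = 0 by apply: contra_notP nF1 => /eqP; exact: HF1.
    have -> : bary (chi p) v = 0 by apply: contra_notP nF2 => /eqP; exact: HF2.
    have -> : bary (psi p) v = 0 by apply: contra_notP nF3 => /eqP; exact: HF3.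
    by rewrite !mulr0 !addr0.
  have -> : (fun z => bary (H z) v) = (fun z => w z v).
    by apply/funext => z; rewrite HE.
  rewrite /w; apply: continuous_add; first apply: continuous_add.
  - by apply: continuous_mul; [exact: csnd|exact: (cfst (fun p => bary (phi p) v) (tphi.2 v))].
  - by apply: continuous_mul; [exact: csnd|exact: (cfst (fun p => bary (chi p) v) (tchi.2 v))].
  - by apply: continuous_mul; [exact: csnd|exact: (cfst (fun p => bary (psi p) v) (tpsi.2 v))].
have [a_0 c_0] : a 0 = 1 /\ c 0 = 0.
  rewrite /a /c mulr0 subr0 sub0r (max_idPr ler01) minxx.
  by rewrite (max_idPl _) ?lerN10 ?(min_idPr _).
have [a_1 c_1] : a 1 = 0 /\ c 1 = 1.
  have two : 2 * 1 - 1 = 1 :> k by rewrite mulr1 -addrA subrr addr0.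
  rewrite /a /c two (max_idPr ler01) minxx -opprB two.
  by rewrite (max_idPl _) ?lerN10 ?(min_idPr _).
exists H; split.
- exact: continuous_subspaceT.
- move=> p; apply: realization_ext => v.
  by rewrite HE /w /b /= a_0 c_0 subrr subr0 !mul0r !addr0 mul1r.
- move=> p; apply: realization_ext => v.
  by rewrite HE /w /b /= a_1 c_1 subr0 subrr !mul0r !add0r mul1r.
Qed.

End tame_maps.

(** * Tameness and simplicial maps *)

Section simplicial_tameness.
Context {k : realType} {V W : Type}.
Context {K : simplicial_complex V} {L : simplicial_complex W}.

Lemma tame_id : tame (fun p : realization k K => bary p).
Proof.
split=> [s Ks|v]; last exact: bary_continuous.
by exists s => //; exact: simplex_finite Ks.
Qed.

(** Coordinates of the image are sums over fibres of [F], continuous by local finiteness. *)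
Lemma tame_realization_map (U : Type) (J : simplicial_complex U)
    (F : simplicial_map K L) (phi : realization k J -> realization k K) :
  tame (fun p => bary (phi p)) ->
  tame (fun p => bary (realization_map k F (phi p))).
Proof.
move=> tphi; split=> [s Js|w]; last exact: tame_sum_continuous.
have [A finA phiA] := tphi.1 s Js.
exists (F @` A); first exact: finite_image.
by move=> p sp; rewrite push_bary_support; apply: image_subset; exact: phiA.
Qed.

(** The closed simplex [s] is carried into the one on the image of [s], whose finite bound therefore
    serves for [s]. *)
Lemma tame_precomp (U : Type) (F : simplicial_map K L)
    (Phi : realization k L -> U -> k) :
  tame Phi -> tame (fun p => Phi (realization_map k F p)).
Proof.
move=> tPhi; split=> [s Ks|u].
  have [A finA PhiA] := tPhi.1 _ (simplicial_map_image F Ks).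
  exists A => // p sp; apply: PhiA; rewrite /closed_simplex /= push_bary_support.
  exact: image_subset.
have cF : continuous (realization_map k F).
  by apply: tame_continuous; apply: tame_realization_map; exact: tame_id.
move=> p; apply: (@continuous_comp _ _ _ _ (fun q => Phi q u)); first exact: cF.
exact: tPhi.2.
Qed.

End simplicial_tameness.

(** * The threshold and the vertices above it *)

Section threshold.
Context {k : realType} {V : Type} {K : simplicial_complex V}.
Implicit Types p : realization k K.

(* Half of the sum of squares is below the largest coordinate, since the
   coordinates sum to 1; unlike the maximum, it is a finite sum of continuous
   functions on each closed simplex. *)
Definition threshold p : k := (\sum_(v \in [set: {classic V}]) bary p v ^+ 2) / 2.

(** A continuous substitute for the indicator of the vertices above the threshold. *)
Definition excess p (v : V) : k := Num.max 0 (bary p v - threshold p).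

Lemma threshold_gt0 p : 0 < threshold p.
Proof.
rewrite divr_gt0// (@weights_sum_gt0 k V K (fun v => bary p v ^+ 2))//.
  by move=> v; exact: sqr_ge0.
suff -> : [set v | bary p v ^+ 2 != 0] = [set v | bary p v != 0].
  exact: bary_support.
by apply/seteqP; split=> v /=; rewrite sqrf_eq0.
Qed.

(** Were all coordinates at most c = [threshold p], the sum of squares 2c would be at most c times
    the sum of coordinates, which is c, contrary to c > 0. *)
Lemma threshold_lt_bary p : exists v, threshold p < bary p v.
Proof.
apply: contrapT => nex; have le_thr v : bary p v <= threshold p.
  by rewrite leNgt; apply/negP => lt; apply: nex; exists v.
pose S : set {classic V} := [set v | bary p v != 0].
have finS : finite_set S by exact: simplex_finite (bary_support p).
have : 2 * threshold p <= threshold p.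
  rewrite {1}/threshold mulrC divfK ?pnatr_eq0// -(fsbig_widen S) //; last first.
    by move=> v [_ /= /negP]; rewrite negbK => /eqP ->; rewrite expr0n.
  rewrite fsbig_finite// -[leRHS]mulr1 -(@bary_sum_seq _ _ _ p S)// mulr_sumr.
  by apply: ler_sum => v _; rewrite expr2 ler_wpM2r// bary_ge0.
by rewrite mulr_natl mulr2n gerDl leNgt threshold_gt0.
Qed.

Lemma threshold_support p v : threshold p < bary p v -> bary p v != 0.
Proof. by move=> /(lt_trans (threshold_gt0 p)); rewrite lt0r => /andP[]. Qed.

Lemma threshold_continuous : continuous threshold.
Proof.
apply: continuous_mul; last exact: continuous_const.
apply: tame_sum_continuous; split=> [s Ks|v].
  exists s; first exact: simplex_finite Ks.
  by move=> p sp v /=; rewrite sqrf_eq0; exact: sp.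
by under eq_fun do rewrite expr2; apply: continuous_mul; exact: bary_continuous.
Qed.

Lemma excess_ge0 p v : 0 <= excess p v.
Proof. by rewrite le_max lexx. Qed.

Lemma excess_neq0 p v : (excess p v != 0) = (threshold p < bary p v).
Proof.
rewrite /excess; case: (ltP (threshold p)) => h.
  by rewrite (max_idPr _) ?subr_ge0 ?ltW// subr_eq0 gt_eqF.
by rewrite (max_idPl _) ?subr_le0// eqxx.
Qed.


Lemma excess_continuous v : continuous (excess^~ v).
Proof.
apply: continuous_maxr; first exact: continuous_const.
by apply: continuous_sub; [exact: bary_continuous|exact: threshold_continuous].
Qed.

Lemma tame_excess : tame excess.
Proof.
split=> [s Ks|v]; last exact: excess_continuous.
exists s; first exact: simplex_finite Ks.
by move=> p sp v; rewrite /= excess_neq0 => /threshold_support; exact: sp.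
Qed.

(** A vertex outside [A] carries at most the mass missing from [A]; this is what makes the cutoff in
    [simplex_weight] work. *)
Lemma bary_sum_notin p (A : set {classic V}) v : finite_set A -> ~ A v ->
  bary p v + \sum_(u <- fset_set A) bary p u <= 1.
Proof.
move=> finA nAv; pose S : set {classic V} := [set u | bary p u != 0].
have finS : finite_set S by exact: simplex_finite (bary_support p).
pose G : set {classic V} := v |` A `|` S.
have finG : finite_set G by rewrite !finite_setU.
rewrite -(@bary_sum_seq _ _ _ p _ finG); last by move=> u; right.
rewrite -!fsbig_finite// [leRHS](fsbigID A)// addrC.
have -> : G `&` A = A by apply/setIidr => u Au; left; right.
rewrite lerD2l (fsbigD1 (v : {classic V}))//=.
- by rewrite lerDl fsumr_ge0// => u _; exact: bary_ge0.
- exact: finite_setIl.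
- by split=> //; left; left.
Qed.
End threshold.

(** * Weights on the simplices between the high vertices and the support *)

Section witness_weights.
Context {k : realType} {X Y : Type} {R : set (X * Y)}.
Notation D := (dowker_complex R).
Implicit Types (p : realization k D) (t : set X).

(* The product forces t <= supp p. Positivity of the second factor says that the
   mass of p outside t is below the threshold, which forces every vertex above
   the threshold into t. *)
Definition simplex_weight p (t : {classic (set X)}) : k :=
  if `[< D t >] then
    (\prod_(x <- fset_set (t : set {classic X})) bary p x) *
    Num.max 0 (\sum_(x <- fset_set (t : set {classic X})) bary p x - 1 + threshold p)
  else 0.

Lemma simplex_weight_ge0 p t : 0 <= simplex_weight p t.
Proof.
rewrite /simplex_weight; case: asboolP => // _.
by rewrite mulr_ge0 ?le_max ?lexx// prodr_ge0// => x _; exact: bary_ge0.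
Qed.

Lemma simplex_weight_neq0 p t : simplex_weight p t != 0 ->
  [/\ D t, t `<=` [set x | bary p x != 0] &
      [set x | threshold p < bary p x] `<=` t].
Proof.
rewrite /simplex_weight; case: asboolP => [Dt|_]; last by rewrite eqxx.
have fint : finite_set (t : set {classic X}) by exact: simplex_finite Dt.
rewrite mulf_eq0 => /norP[prod0 max0]; split=> // x.
  move=> tx /=; move: prod0; rewrite prodf_seq_neq0 => /allP; apply.
  by rewrite in_fset_set//; exact: mem_set.
move=> /= thr; apply: contrapT => ntx; move/negP: max0; apply; apply/eqP/max_idPl.
have := bary_sum_notin p fint ntx; lra.
Qed.

(** The full support has mass 1, so its second factor is the threshold itself. Hence the simplex
    weights never all vanish. *)
Lemma simplex_weight_support p : simplex_weight p [set x | bary p x != 0] != 0.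
Proof.
pose S : set {classic X} := [set x | bary p x != 0].
have finS : finite_set S by exact: simplex_finite (bary_support p).
rewrite /simplex_weight asboolT; last exact: bary_support.
rewrite -/S bary_sum_seq// subrr add0r (max_idPr _) ?ltW ?threshold_gt0//.
apply: mulf_neq0; last by rewrite gt_eqF// threshold_gt0.
rewrite prodf_seq_neq0.
by apply/allP => x; rewrite in_fset_set// => /set_mem.
Qed.

Lemma tame_simplex_weight : tame simplex_weight.
Proof.
split=> [s Ds|t].
  exists [set t : {classic (set X)} | t `<=` s].
    by apply: (@finite_subsets {classic X}); exact: simplex_finite Ds.
  by move=> p sp t /simplex_weight_neq0[_ tp _]; exact: subset_trans sp.
rewrite /simplex_weight; case: asboolP => _; last exact: continuous_const.
apply: continuous_mul; first by apply: continuous_prod => x; exact: bary_continuous.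
apply: continuous_maxr; first exact: continuous_const.
apply: continuous_add; last exact: threshold_continuous.
apply: continuous_add; last exact: continuous_const.
by apply: continuous_sum => x; exact: bary_continuous.
Qed.

End witness_weights.

(** * The homotopy inverse and the two homotopies *)

Section inverse_up_to_homotopy.
Context (k : realType) {X Y : Type} (R : set (X * Y)).
Notation D := (dowker_complex R).
Notation E := (rectangle_complex R).
Notation pi := (realization_map k (rel_fst_map R)).

(** Option-valued, since a set of vertices may have no witness and [Y] may be empty. *)
Context (wit : set X -> option Y).
Context (wit_sub : forall t y, wit t = Some y -> t `*` [set y] `<=` R).
Context (wit_ex : forall t, D t -> exists y, wit t = Some y).

(** An unnormalized product distribution: the excess on [X] times the simplex weights pushed forward
    along [wit] to [Y]. *)
Definition rectangle_weight (p : realization k D) (r : R) : k :=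
  excess p (rel_fst r) *
  \sum_(t \in [set t : {classic (set X)} | wit t = Some (rel_snd r)])
    simplex_weight p t.

Lemma rectangle_weight_ge0 p r : 0 <= rectangle_weight p r.
Proof.
rewrite mulr_ge0 ?excess_ge0 ?fsumr_ge0// => t _; exact: simplex_weight_ge0.
Qed.

Lemma rectangle_weight_neq0 p r : rectangle_weight p r != 0 ->
  threshold p < bary p (rel_fst r) /\
  exists2 t, simplex_weight p t != 0 & wit t = Some (rel_snd r).
Proof.
rewrite mulf_eq0 => /norP[]; rewrite excess_neq0 => thr sum0; split=> //.
apply: contrapT => nex; move/eqP: sum0; apply; apply: fsbig1 => t /= wt.
by apply: contrapT => /eqP tp; apply: nex; exists t.
Qed.

(** A witness of nonzero weight comes from a simplex containing every vertex above the threshold, so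
    it is related to all of them. *)
Lemma rectangle_weight_in p r x : rectangle_weight p r != 0 ->
  threshold p < bary p x -> R (x, rel_snd r).
Proof.
move=> /rectangle_weight_neq0[_ [t /simplex_weight_neq0[_ _ tp] wt]] thr.
by apply: (@wit_sub _ _ wt (x, rel_snd r)); split=> //=; exact: tp.
Qed.

Lemma tame_rectangle_weight : tame rectangle_weight.
Proof.
split=> [s Ds|r]; last first.
  apply: continuous_mul; first exact: excess_continuous.
  exact/tame_sum_continuous/tame_simplex_weight.
(* [Some] matches the codomain of [wit]; the candidates are then the preimage of a finite product
   under an injection. *)
pose coord (r : R) := (rel_fst r, Some (rel_snd r)).
exists (coord @^-1` (s `*` (wit @` [set t | t `<=` s]))).
  apply: finite_preimage.
    move=> r r' _ _ [r1 r2]; apply: val_inj.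
    by rewrite [val r]surjective_pairing [val r']surjective_pairing; congr pair.
  apply: finite_setX; first exact: simplex_finite Ds.
  apply: finite_image.
  by apply: (@finite_subsets {classic X}); exact: simplex_finite Ds.
move=> p sp r /rectangle_weight_neq0[thr [t /simplex_weight_neq0[_ tp _] wt]].
split; first exact/sp/threshold_support.
by exists t; first exact: subset_trans sp.
Qed.

(** Pair a vertex above the threshold with the witness of the full support. *)
Lemma rectangle_weight_support_neq0 p : [set r | rectangle_weight p r != 0] !=set0.
Proof.
have [x thr] := threshold_lt_bary p.
have Dp := bary_support p; have [y wy] := wit_ex Dp.
have px : [set x | bary p x != 0] x by exact: threshold_support.
have Rxy : R (x, y) by apply: (@wit_sub _ _ wy (x, y)).
exists (SigSub (mem_set Rxy)); apply: mulf_neq0; first by rewrite excess_neq0.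
have [F finF pF] := (@tame_simplex_weight k X Y R).1 _ Dp.
apply: (fsum_neq0 (simplex_weight_ge0 p) finF (pF p (fun _ => id)) wy).
exact: simplex_weight_support.
Qed.

Lemma rectangle_weight_simplex p : E [set r | rectangle_weight p r != 0].
Proof.
split; last 2 first.
- exact: rectangle_weight_support_neq0.
- move=> [x y] [/= [r rp <-] [r' r'p <-]]; apply: rectangle_weight_in r'p _.
  by have [] := rectangle_weight_neq0 rp.
have [F finF pF] := tame_rectangle_weight.1 _ (bary_support p).
by apply: sub_finite_set finF; exact: pF.
Qed.

(** The map h before normalization: the excess factor removes low vertices continuously. *)
Definition trimmed_weight (e : realization k E) (r : R) : k :=
  excess (pi e) (rel_fst r) * bary e r.

Lemma trimmed_weight_neq0 e r : (trimmed_weight e r != 0) =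
  (threshold (pi e) < bary (pi e) (rel_fst r)) && (bary e r != 0).
Proof. by rewrite mulf_eq0 negb_or excess_neq0. Qed.

Lemma bary_pi_neq0 e x : bary (pi e) x != 0 ->
  exists2 r, bary e r != 0 & rel_fst r = x.
Proof.
move=> ex; have : [set x | bary (pi e) x != 0] x by [].
by rewrite push_bary_support.
Qed.

Lemma trimmed_weight_simplex e : E [set r | trimmed_weight e r != 0].
Proof.
apply: simplex_face (bary_support e) _ _.
  have [x thr] := threshold_lt_bary (pi e).
  have [|r er rx] := @bary_pi_neq0 e x.
    exact: threshold_support.
  by exists r; rewrite /= trimmed_weight_neq0 rx thr.
by move=> r /=; rewrite trimmed_weight_neq0 => /andP[].
Qed.

Lemma tame_trimmed_weight : tame trimmed_weight.
Proof.
split=> [s Es|r].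
  exists s; first exact: simplex_finite Es.
  by move=> p sp r /=; rewrite trimmed_weight_neq0 => /andP[_]; exact: sp.
apply: continuous_mul; last exact: bary_continuous.
exact: (tame_precomp (rel_fst_map R) tame_excess).2.
Qed.

(** All first coordinates are above the threshold. Such a vertex is related to every weighted
    witness, and to every second coordinate in the support of [e] because that support spans a
    rectangle. *)
Lemma trimmed_rectangle_simplex e :
  E ([set r | rectangle_weight (pi e) r != 0] `|` [set r | trimmed_weight e r != 0]).
Proof.
split.
- rewrite finite_setU; split; apply: simplex_finite.
    exact: rectangle_weight_simplex.
  exact: trimmed_weight_simplex.
- by have [r er] := rectangle_weight_support_neq0 (pi e); exists r; left.
move=> [x y] [/= [r rA <-] [r' r'A <-]].
have thr : threshold (pi e) < bary (pi e) (rel_fst r).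
  case: rA => [/rectangle_weight_neq0[]//|].
  by rewrite /= trimmed_weight_neq0 => /andP[].
case: r'A => [r'A|]; first exact: rectangle_weight_in r'A thr.
rewrite /= trimmed_weight_neq0 => /andP[_ er'].
(* [r] need not be a vertex of [e]; [q] is one with the same first coordinate. *)
have [|q eq qr] := @bary_pi_neq0 e (rel_fst r).
  exact: threshold_support.
have [_ _ eR] := bary_support e.
by apply: (eR (_, _)); split=> /=; [exists q|exists r'].
Qed.

Lemma rel_fst_homotopy_equivalence : homotopy_equivalence k pi.
Proof.
have tpi : tame (fun e => bary (pi e)) by apply: tame_realization_map tame_id.
have [g [tg gE]] := tame_normalize tame_rectangle_weight rectangle_weight_ge0
  rectangle_weight_simplex.
have trimmed_ge0 e r : 0 <= trimmed_weight e r.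
  by rewrite mulr_ge0 ?excess_ge0 ?bary_ge0.
have [h [th hE]] := tame_normalize tame_trimmed_weight trimmed_ge0
  trimmed_weight_simplex.
have [tidE tidD] := (@tame_id k _ E, @tame_id k _ D).
split; first exact: tame_continuous.
exists g; split; first exact: tame_continuous.
- apply: (@contiguous_homotopic _ _ _ _ _ (g \o pi) h idfun) => //.
  + exact: tame_precomp tg.
  + by move=> e; rewrite /= gE hE; exact: trimmed_rectangle_simplex.
  + move=> e; have -> : [set r | bary (h e) r != 0] `|` [set r | bary e r != 0] =
        [set r | bary e r != 0]; last exact: bary_support.
    rewrite hE; apply/setUidPr => r /=.
    by rewrite trimmed_weight_neq0 => /andP[].
(* One straight line suffices, so the middle map is the identity too. *)
- apply: (@contiguous_homotopic _ _ _ _ _ (pi \o g) idfun idfun) => //.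
  + exact: tame_realization_map tg.
  + move=> p; have -> : [set x | bary ((pi \o g) p) x != 0] `|`
        [set x | bary p x != 0] = [set x | bary p x != 0]; last exact: bary_support.
    rewrite push_bary_support gE; apply/setUidPr => _ [r rp <-] /=.
    have [thr _] := rectangle_weight_neq0 rp.
    exact: threshold_support.
  + by move=> p; rewrite setUid; exact: bary_support.
Qed.

End inverse_up_to_homotopy.

Theorem theorem4p3 (k : realType) (X Y : Type) (R : set (X * Y)) :
  homotopy_equivalence k (realization_map k (rel_fst_map R)).
Proof.
pose P (t : set X) (y : Y) := t `*` [set y] `<=` R.
(* Classical choice of a witness for every set that has one. *)
pose wit t := if pselect (exists y, P t y) is left ex then Some (projT1 (cid ex))
  else None.
apply: (@rel_fst_homotopy_equivalence k X Y R wit) => t.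
  by move=> y; rewrite /wit; case: pselect => // ex [<-]; exact: projT2 (cid ex).
move=> [_ _ exy]; rewrite /wit; case: pselect => // ex.
by exists (projT1 (cid ex)).
Qed.
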